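(* Let $M$ be a smooth manifold and let $\mathcal I_1,\mathcal I_2$ be two generalized complex structures on $M$ with $\mathcal I_1\neq\pm\mathcal I_2$. Then $\mathcal I_1$ and $\mathcal I_2$ are part of a generalized hypercomplex family on $M$ if and only if there is a real number (constant) $p$ with $|p|<1$ such that $$\mathcal I_1\mathcal I_2+\mathcal I_2\mathcal I_1=2p\,\mathrm{Id}.$$
   Context: On $TM\oplus T^*M$ consider the pairing $\langle X+\xi,Y+\eta\rangle=\frac12(\xi(Y)+\eta(X))$ and the Courant bracket $[X+\xi,Y+\eta]=[X,Y]+L_X\eta-L_Y\xi-\frac12 d(i_X\eta-i_Y\xi)$. A generalized almost complex structure on $M$ is a smooth bundle endomorphism $\mathcal I$ of $TM\oplus T^*M$ with $\mathcal I^2=-\mathrm{Id}$ that is orthogonal for $\langle\cdot,\cdot\rangle$. It is called integrable, and then a generalized complex structure, if the space of sections of its $\sqrt{-1}$-eigenbundle in $(TM\oplus T^*M)\otimes\mathbb C$ is closed under the complexified Courant bracket. A generalized almost hypercomplex structure on $M$ is a triple $(\mathcal I,\mathcal J,\mathcal K)$ of pairwise anti-commuting generalized almost complex structures with $\mathcal K=\mathcal I\mathcal J$. It is a generalized hypercomplex structure if every member of the $S^2$-family $\{a\mathcal I+b\mathcal J+c\mathcal K: (a,b,c)\in\mathbb R^3,\ a^2+b^2+c^2=1\}$ is a generalized complex structure (integrable); this family is then called a generalized hypercomplex family. ''Part of a generalized hypercomplex family'' means that both structures are members of one such family. *)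

(* Defs.v *)
From HB Require Import structures.
From mathcomp Require Export all_boot all_order all_algebra.
From mathcomp Require Export complex.
From mathcomp Require Export boolp classical_sets functions cardinality.
From mathcomp Require Export reals topology normedtype derive.
Export numFieldNormedType.Exports.

Set Implicit Arguments.
Unset Strict Implicit.
Unset Printing Implicit Defensive.

Import Order.TTheory GRing.Theory Num.Theory.
Local Open Scope classical_set_scope.
Local Open Scope ring_scope.

(** * Smooth maps between open subsets of R^n *)

(* C^oo: every iterated directional derivative (of any order, including 0)
   exists and is (Frechet) differentiable at each point of [U].  [U] is meant
   to be open; the values of [f] outside [U] are irrelevant. *)
Definition smooth_on (R : realType) (V W : normedModType R)
    (U : set V) (f : V -> W) : Prop :=
  forall (vs : seq V) (p : V), U p ->
    differentiable (foldr (fun (v : V) (g : V -> W) => 'D_v g) f vs) p.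

Definition basis_vec (R : realType) (n : nat) (j : 'I_n) : 'cV[R]_n :=
  delta_mx j 0.

Definition jacobian_mx (R : realType) (n m : nat)
    (f : 'cV[R]_n -> 'cV[R]_m) (p : 'cV[R]_n) : 'M[R]_(m, n) :=
  \matrix_(i, j) ('D_(basis_vec R j) f p) i 0.

(** * Smooth manifolds *)

(* A homeomorphism from the open set [dom] of [T] onto the open set [cod] of
   R^n; [coord] and its inverse [icoord] are total functions with irrelevant
   values outside [dom] and [cod]. *)
Record chart (R : realType) (n : nat) (T : topologicalType) := Chart {
  dom : set T;
  cod : set 'cV[R]_n;
  coord : T -> 'cV[R]_n;
  icoord : 'cV[R]_n -> T;
  dom_open : open dom;
  cod_open : open cod;
  coord_cod : forall x, dom x -> cod (coord x);
  icoord_dom : forall p, cod p -> dom (icoord p);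
  coordK : forall x, dom x -> icoord (coord x) = x;
  icoordK : forall p, cod p -> coord (icoord p) = p;
  coord_continuous : {within dom, continuous coord};
  icoord_continuous : {within cod, continuous icoord}
}.

(* The atlas need not be maximal.  [chart_at] selects one chart of the atlas
   around every point; it serves as a frame for the fibres of the bundles
   below and carries no further condition. *)
Record smoothManifold (R : realType) (n : nat) := SmoothManifold {
  carrier :> topologicalType;
  carrier_hausdorff : hausdorff_space carrier;
  carrier_second_countable : @second_countable carrier;
  atlas : set (chart R n carrier);
  transition_smooth : forall c c', atlas c -> atlas c' ->
    smooth_on (cod c `&` [set p | dom c' (icoord c p)])
              (fun p => coord c' (icoord c p));
  chart_at : carrier -> chart R n carrier;
  chart_at_atlas : forall x, atlas (chart_at x);
  chart_at_dom : forall x, dom (chart_at x) x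
}.

(** * The bundle TM (+) T*M *)

(* A point X + xi of the fibre at x is given by its components in the chart
   [chart_at x]: the column of the n components of X (in the frame d/dx^i)
   above the column of the n components of xi (in the coframe dx^i).
   So sections are maps to 'cV_(n + n), bundle endomorphisms are maps to
   'M_(n + n), and composition of endomorphisms is fibrewise [*m]. *)

Definition vec_part (R : realType) (n : nat) (u : 'cV[R]_(n + n)) : 'cV[R]_n :=
  usubmx u.

Definition form_part (R : realType) (n : nat) (u : 'cV[R]_(n + n)) : 'cV[R]_n :=
  dsubmx u.

(* xi(X) = i_X xi *)
Definition eval_form (R : realType) (n : nat) (xi X : 'cV[R]_n) : R :=
  \sum_i xi i 0 * X i 0.

Definition pairing (R : realType) (n : nat) (u v : 'cV[R]_(n + n)) : R :=
  2^-1 * (eval_form (form_part u) (vec_part v)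
          + eval_form (form_part v) (vec_part u)).

Definition gsection (R : realType) (n : nat) (M : smoothManifold R n) : Type :=
  M -> 'cV[R]_(n + n).

Definition gendo (R : realType) (n : nat) (M : smoothManifold R n) : Type :=
  M -> 'M[R]_(n + n).

(* Change of components at x from the chart [c] to the chart [c'].  Vectors
   transform by the Jacobian D(c' o c^-1), covectors by the inverse transpose,
   i.e. by the transpose of D(c o c'^-1). *)
Definition frame_change (R : realType) (n : nat) (T : topologicalType)
    (c c' : chart R n T) (x : T) : 'M[R]_(n + n) :=
  block_mx
    (jacobian_mx (fun p => coord c' (icoord c p)) (coord c x)) 0
    0 (jacobian_mx (fun p => coord c (icoord c' p)) (coord c' x))^T.

Definition section_in_chart (R : realType) (n : nat) (M : smoothManifold R n)
    (c : chart R n M) (u : gsection M) : 'cV[R]_n -> 'cV[R]_(n + n) :=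
  fun p => let x := icoord c p in frame_change (chart_at x) c x *m u x.

Definition endo_in_chart (R : realType) (n : nat) (M : smoothManifold R n)
    (c : chart R n M) (A : gendo M) : 'cV[R]_n -> 'M[R]_(n + n) :=
  fun p => let x := icoord c p in
    frame_change (chart_at x) c x *m A x *m frame_change c (chart_at x) x.

Definition smooth_section (R : realType) (n : nat) (M : smoothManifold R n)
    (u : gsection M) : Prop :=
  forall c, atlas c -> smooth_on (cod c) (section_in_chart c u).

Definition smooth_endo (R : realType) (n : nat) (M : smoothManifold R n)
    (A : gendo M) : Prop :=
  forall c, atlas c -> smooth_on (cod c) (endo_in_chart c A).

(** * The Courant bracket *)

(* On R^n a vector field or a 1-form is its map of components
   'cV_n -> 'cV_n. *)

Definition lie_bracket (R : realType) (n : nat)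
    (X Y : 'cV[R]_n -> 'cV[R]_n) (p : 'cV[R]_n) : 'cV[R]_n :=
  'D_(X p) Y p - 'D_(Y p) X p.

(* (L_X eta)_i = sum_j (X^j d_j eta_i + eta_j d_i X^j) *)
Definition lie_form (R : realType) (n : nat)
    (X eta : 'cV[R]_n -> 'cV[R]_n) (p : 'cV[R]_n) : 'cV[R]_n :=
  'D_(X p) eta p + \col_i eval_form (eta p) ('D_(basis_vec R i) X p).

Definition ext_diff (R : realType) (n : nat)
    (f : 'cV[R]_n -> R) (p : 'cV[R]_n) : 'cV[R]_n :=
  \col_i 'D_(basis_vec R i) f p.

Definition courant_bracket_local (R : realType) (n : nat)
    (u v : 'cV[R]_n -> 'cV[R]_(n + n)) (p : 'cV[R]_n) : 'cV[R]_(n + n) :=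
  let X := fun q => vec_part (u q) in
  let xi := fun q => form_part (u q) in
  let Y := fun q => vec_part (v q) in
  let eta := fun q => form_part (v q) in
  col_mx (lie_bracket X Y p)
    (lie_form X eta p - lie_form Y xi p
     - 2^-1 *: ext_diff
         (fun q => eval_form (eta q) (X q) - eval_form (xi q) (Y q)) p).

(* The formula is invariant under changes of coordinates, so it may be
   evaluated at x in the chart [chart_at x], where its components are the
   coordinates of the value in the fibre at x. *)
Definition courant_bracket (R : realType) (n : nat) (M : smoothManifold R n)
    (u v : gsection M) : gsection M :=
  fun x => let c := chart_at x in
    courant_bracket_local (section_in_chart c u) (section_in_chart c v)
      (coord c x).

(** * Complexification *)

Definition csection (R : realType) (n : nat) (M : smoothManifold R n) : Type :=
  M -> 'cV[R[i]]_(n + n).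

Definition re_section (R : realType) (n : nat) (M : smoothManifold R n)
    (u : csection M) : gsection M :=
  fun x => map_mx (@complex.Re R) (u x).

Definition im_section (R : realType) (n : nat) (M : smoothManifold R n)
    (u : csection M) : gsection M :=
  fun x => map_mx (@complex.Im R) (u x).

Definition smooth_csection (R : realType) (n : nat) (M : smoothManifold R n)
    (u : csection M) : Prop :=
  smooth_section (re_section u) /\ smooth_section (im_section u).

(* The C-bilinear extension:
   [a + ib, c + id] = ([a, c] - [b, d]) + i ([a, d] + [b, c]). *)
Definition ccourant_bracket (R : realType) (n : nat) (M : smoothManifold R n)
    (u v : csection M) : csection M :=
  fun x => \col_k
    Complex
      ((courant_bracket (re_section u) (re_section v) x
        - courant_bracket (im_section u) (im_section v) x) k 0)
      ((courant_bracket (re_section u) (im_section v) x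
        + courant_bracket (im_section u) (re_section v) x) k 0).

Definition in_i_eigenbundle (R : realType) (n : nat) (M : smoothManifold R n)
    (A : gendo M) (u : csection M) : Prop :=
  forall x, map_mx (real_complex R) (A x) *m u x = 'i%C *: u x.

(** * Generalized complex and hypercomplex structures *)

Definition gen_almost_complex (R : realType) (n : nat) (M : smoothManifold R n)
    (A : gendo M) : Prop :=
  [/\ smooth_endo A,
      (forall x, A x *m A x = - 1%:M)
    & forall x (u v : 'cV[R]_(n + n)),
        pairing (A x *m u) (A x *m v) = pairing u v].

(* The bracket of smooth sections is again smooth, so closedness only concerns
   its values. *)
Definition integrable (R : realType) (n : nat) (M : smoothManifold R n)
    (A : gendo M) : Prop :=
  forall u v : csection M,
    smooth_csection u -> smooth_csection v ->
    in_i_eigenbundle A u -> in_i_eigenbundle A v ->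
    in_i_eigenbundle A (ccourant_bracket u v).

Definition gen_complex (R : realType) (n : nat) (M : smoothManifold R n)
    (A : gendo M) : Prop :=
  gen_almost_complex A /\ integrable A.

Definition anticommute (R : realType) (n : nat) (M : smoothManifold R n)
    (A B : gendo M) : Prop :=
  forall x, A x *m B x = - (B x *m A x).

Definition gen_almost_hypercomplex (R : realType) (n : nat)
    (M : smoothManifold R n) (I J K : gendo M) : Prop :=
  [/\ gen_almost_complex I, gen_almost_complex J & gen_almost_complex K] /\
  [/\ anticommute I J, anticommute J K, anticommute I K
    & forall x, K x = I x *m J x].

Definition sphere_family (R : realType) (n : nat) (M : smoothManifold R n)
    (I J K : gendo M) : set (gendo M) :=
  [set A | exists a b c : R, a ^+ 2 + b ^+ 2 + c ^+ 2 = 1 /\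
     forall x, A x = a *: I x + b *: J x + c *: K x].

Definition gen_hypercomplex (R : realType) (n : nat) (M : smoothManifold R n)
    (I J K : gendo M) : Prop :=
  gen_almost_hypercomplex I J K /\
  forall A, sphere_family I J K A -> gen_complex A.

Definition part_of_hypercomplex_family (R : realType) (n : nat)
    (M : smoothManifold R n) (A B : gendo M) : Prop :=
  exists I J K : gendo M, gen_hypercomplex I J K /\
    sphere_family I J K A /\ sphere_family I J K B.

(* Main.v *)
From HB Require Import structures.
From mathcomp Require Import all_boot all_order all_algebra.
From mathcomp Require Import ring lra.
From mathcomp Require Import reals landau.
Require Import Defs.
Import Order.TTheory GRing.Theory Num.Theory.
Local Open Scope classical_set_scope.
Local Open Scope ring_scope.

Set Implicit Arguments.
Unset Strict Implicit.
Unset Printing Implicit Defensive.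

(** Members of a sphere family multiply like imaginary quaternions: the
    anticommutator of two of them is the scalar -2<v, w>, where v and w are
    their coordinate vectors.  By Cauchy-Schwarz |<v, w>| < 1 unless the two
    members are equal or opposite, which gives the constant p = -<v, w>.

    Conversely, put J = (I2 + p I1) / sqrt (1 - p^2).  It is an orthogonal
    almost complex structure anticommuting with I1, and
    I2 = - p I1 + sqrt (1 - p^2) J is a member of the sphere family of
    I = I1, J and K = I1 J.  What has to be shown is that the integrability of
    I and of one further member a I + b J with b <> 0 propagates to the whole
    sphere [integrable_sphere].

    Fix a point x and consider the real trilinear form
    tau (phi, u, v) = phi ([u, v] (x)), where phi is a covector on the fibre
    and u, v are smooth sections.  The quaternions act on each of the three
    arguments (on phi by A . phi = - phi A).  For a member A let e_A tau be the
    sum of the three forms obtained from tau by letting A act on two of the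
    arguments.  Then A is integrable if and only if e_A tau = tau at every
    point [integrable_bracket_form]; over C this says that tau has no
    component of extreme weight +3 or -3 under A in the tensor product of
    three two-dimensional representations.

    That tensor product is a sum of copies of the spin 3/2 and of the spin 1/2
    representation, and extreme weights occur in spin 3/2 only.  Hence all
    members are integrable if and only if tau has no spin 3/2 part, that is, if
    and only if the Casimir sum e_I + e_J + e_K takes the value 3 on tau (its
    value on spin 3/2 is -3).  Two non-proportional integrable members suffice,
    because a spin 3/2 vector is a binary cubic, and A, - A, B, - B would be
    four roots of it.  Both steps are carried out as identities between the
    operators e_A: [pairsum_anticomm] yields the Casimir value from two
    integrable members, and [pairsum_casimir] yields e_A tau = tau from the
    Casimir value.

    The analysis serves to make tau available: smooth sections form a real
    vector space on which smooth endomorphisms act (products of smooth maps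
    are smooth, and the Jacobians of mutually inverse coordinate changes are
    inverse matrices), and the bracket is real bilinear on them. *)

(** * Smooth maps *)

Lemma near_eq_differentiable (R : realType) (V W : normedModType R)
    (f g : V -> W) (p : V) :
  (\near p, f p = g p) -> differentiable f p -> differentiable g p.
Proof.
move=> fg /diff_locallyP [fc fo].
suff go : g \o shift p = cst (g p) + 'd f p +o_ 0 id.
  apply/diff_locallyP.
  have -> : 'd g p = 'd f p :> (_ -> _) by apply: diff_unique.
  by split.
apply/eqaddoP => e e0; move/eqaddoP: fo => /(_ e e0).
rewrite (nbhs_singleton fg); apply: filter_app.
have : \forall x \near (0 : V), f (x + p) = g (x + p).
  have := fg; rewrite (near_shift 0) /=; near_simpl.
  by apply: filterS => x /=; rewrite subr0.
apply: filterS => x /= E.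
by rewrite -![(_ + _ : _ -> _) _]/(_ + _) -![(- _ : _ -> _) _]/(- _) /= E.
Qed.

Section SmoothOn.
Variables (R : realType) (V W : normedModType R) (U : set V).

(** The recursion on the order of differentiation makes closure properties
    that involve the Leibniz rule provable by induction on that order. *)
Fixpoint differentiable_upto (k : nat) (f : V -> W) : Prop :=
  (forall p, U p -> differentiable f p) /\
  (if k is k'.+1
   then forall v, differentiable_upto k' ('D_v f : V -> W) else True).

Lemma smooth_onP (f : V -> W) :
  smooth_on U f <-> forall k, differentiable_upto k f.
Proof.
split=> [sf k | df].
  elim: k f sf => [|k IHk] f sf; split=> //;
    try by move=> p Up; exact: (sf [::]).
  move=> v; apply: IHk => vs p Up; have := sf (rcons vs v) p Up.
  by rewrite -cats1 foldr_cat.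
move=> vs; elim/last_ind: vs f df => [|vs v IHvs] f df p Up.
  by have [+ _] := df 0%N; apply.
rewrite -cats1 foldr_cat; apply: IHvs => // k.
by have [_ Df] := df k.+1; exact: Df.
Qed.

Hypothesis openU : open U.

Lemma eq_differentiable_upto (k : nat) (f g : V -> W) :
  (forall p, U p -> f p = g p) ->
  differentiable_upto k f -> differentiable_upto k g.
Proof.
have nearU (f1 f2 : V -> W) p : (forall p, U p -> f1 p = f2 p) -> U p ->
    \near p, f1 p = f2 p.
  by move=> e Up; near=> q; apply: e; near: q; exact: open_nbhs_nbhs.
elim: k f g => [|k IHk] f g fg [df Df]; split=> //; try
  by move=> p Up; apply: near_eq_differentiable (df p Up); exact: nearU.
move=> v; apply: IHk (Df v) => p Up.
by apply: near_eq_derive; exact: nearU.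
Unshelve. all: by end_near. Qed.

Lemma differentiable_uptoS (k : nat) (f : V -> W) :
  differentiable_upto k.+1 f -> differentiable_upto k f.
Proof.
elim: k f => [|k IHk] f [df Df]; split=> // v.
exact: IHk.
Qed.

Lemma differentiable_uptoD (k : nat) (f g : V -> W) :
  differentiable_upto k f -> differentiable_upto k g ->
  differentiable_upto k (f + g).
Proof.
elim: k f g => [|k IHk] f g [df Df] [dg Dg]; split=> //; try
  by move=> p Up; apply: differentiableD; [exact: df | exact: dg].
move=> v; apply: eq_differentiable_upto (IHk _ _ (Df v) (Dg v)) => p Up.
by rewrite deriveD //; apply: diff_derivable; [exact: df | exact: dg].
Qed.

Lemma differentiable_uptoZ (k : nat) (a : R) (f : V -> W) :
  differentiable_upto k f -> differentiable_upto k (a *: f).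
Proof.
elim: k f => [|k IHk] f [df Df]; split=> //; try
  by move=> p Up; apply: differentiableZ; exact: df.
move=> v; apply: eq_differentiable_upto (IHk _ (Df v)) => p Up.
by rewrite deriveZ //; apply: diff_derivable; exact: df.
Qed.

Lemma eq_smooth_on (f g : V -> W) :
  (forall p, U p -> f p = g p) -> smooth_on U f -> smooth_on U g.
Proof.
move=> fg /smooth_onP sf; apply/smooth_onP => k.
exact: eq_differentiable_upto (sf k).
Qed.

Lemma smooth_onD (f g : V -> W) :
  smooth_on U f -> smooth_on U g -> smooth_on U (f + g).
Proof.
move=> /smooth_onP sf /smooth_onP sg; apply/smooth_onP => k.
exact: differentiable_uptoD.
Qed.

Lemma smooth_onZ (a : R) (f : V -> W) : smooth_on U f -> smooth_on U (a *: f).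
Proof.
by move=> /smooth_onP sf; apply/smooth_onP => k; exact: differentiable_uptoZ.
Qed.

End SmoothOn.

Section MatrixValued.
Variables (R : realType) (V : normedModType R).

Lemma differentiable_mxP (m n : nat) (F : V -> 'M[R]_(m, n)) (p : V) :
  differentiable F p <-> forall i j, differentiable (fun q => F q i j) p.
Proof.
split=> [dF i j | dF].
  apply: (differentiable_comp (g := fun N : 'M[R]_(m, n) => N i j)) => //.
  exact: differentiable_coord.
(* F is a sum of scalar maps times constant matrices *)
have -> : F = \sum_i \sum_j (fun q => F q i j *: delta_mx i j).
  apply/funext => q; rewrite {1}(matrix_sum_delta (F q)) fct_sumE.
  by apply: eq_bigr => i _; rewrite fct_sumE.
apply: differentiable_sum => i; apply: differentiable_sum => j.
exact: differentiableZl.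
Qed.

Lemma differentiable_mulmx (m n k : nat) (F : V -> 'M[R]_(m, n))
    (G : V -> 'M[R]_(n, k)) (p : V) :
  differentiable F p -> differentiable G p ->
  differentiable (fun q => F q *m G q) p.
Proof.
move=> /differentiable_mxP dF /differentiable_mxP dG.
apply/differentiable_mxP => i j.
have -> : (fun q => (F q *m G q) i j) =
    \sum_l ((fun q => F q i l) * (fun q => G q l j)).
  by apply/funext => q; rewrite !mxE fct_sumE.
by apply: differentiable_sum => l; exact: differentiableM.
Qed.

Lemma derive_mulmx (m n k : nat) (F : V -> 'M[R]_(m, n))
    (G : V -> 'M[R]_(n, k)) (p v : V) :
  differentiable F p -> differentiable G p ->
  'D_v (fun q => F q *m G q) p = 'D_v F p *m G p + F p *m 'D_v G p.
Proof.
move=> dF dG; have dFG := differentiable_mulmx dF dG.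
rewrite !derive_mx; try exact: diff_derivable.
have {}dF i j : derivable (fun q => F q i j) p v.
  by apply: diff_derivable; move: dF => /differentiable_mxP.
have {}dG i j : derivable (fun q => G q i j) p v.
  by apply: diff_derivable; move: dG => /differentiable_mxP.
apply/matrixP => i j; rewrite !mxE.
have -> : (fun q => (F q *m G q) i j) =
    \sum_l ((fun q => F q i l) * (fun q => G q l j)).
  by apply/funext => q; rewrite !mxE fct_sumE.
rewrite derive_sum -?big_split /=; last by move=> l; exact: derivableM.
apply: eq_bigr => l _; rewrite deriveM // !mxE addrC.
by congr (_ + _); rewrite mulrC.
Qed.

(** The Leibniz rule expresses the derivative of a product, on the open set,
    by products in which one factor has lost an order of differentiability. *)
Lemma smooth_on_mulmx (m n k : nat) (U : set V) (F : V -> 'M[R]_(m, n))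
    (G : V -> 'M[R]_(n, k)) :
  open U -> smooth_on U F -> smooth_on U G ->
  smooth_on U (fun q => F q *m G q).
Proof.
move=> openU /smooth_onP sF /smooth_onP sG; apply/smooth_onP => r.
move: (sF r) (sG r); elim: r F G {sF sG} => [|r IHr] F G; last first.
  move=> dF dG; have [[dF0 DF] [dG0 DG]] := (dF, dG).
  split=> [p Up|v].
    by apply: differentiable_mulmx; [exact: dF0 | exact: dG0].
  have := differentiable_uptoD openU (IHr _ _ (DF v) (differentiable_uptoS dG))
    (IHr _ _ (differentiable_uptoS dF) (DG v)).
  apply: eq_differentiable_upto => // p Up.
  by rewrite derive_mulmx //; [exact: dF0 | exact: dG0].
move=> [dF _] [dG _]; split=> // p Up.
by apply: differentiable_mulmx; [exact: dF | exact: dG].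
Qed.

End MatrixValued.

(** * Coordinate changes *)

Lemma deriveE_jacobian_mx (R : realType) (n m : nat)
    (f : 'cV[R]_n -> 'cV[R]_m) (p v : 'cV[R]_n) :
  differentiable f p -> 'D_v f p = jacobian_mx f p *m v.
Proof.
move=> df; rewrite deriveE // {1}(matrix_sum_delta v) linear_sum /=.
apply/colP => i; rewrite summxE mxE; apply: eq_bigr => j _.
rewrite big_ord1 linearZ !mxE /= mulrC.
by rewrite -deriveE.
Qed.

Lemma jacobian_mx_comp_id (R : realType) (n : nat)
    (f g : 'cV[R]_n -> 'cV[R]_n) (p : 'cV[R]_n) :
  differentiable f p -> differentiable g (f p) ->
  (\near p, g (f p) = p) ->
  jacobian_mx g (f p) *m jacobian_mx f p = 1%:M.
Proof.
move=> df dg gfK; apply/matrixP => i j.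
transitivity ((jacobian_mx g (f p) *m jacobian_mx f p *m basis_vec R j) i 0).
  by rewrite /basis_vec -colE [RHS]mxE.
have dgf : differentiable (g \o f) p by exact: differentiable_comp.
have E : 'D_(basis_vec R j) (g \o f) p = 'D_('D_(basis_vec R j) f p) g (f p).
  rewrite (deriveE _ dgf) (deriveE _ df) (deriveE _ dg).
  exact: (congr1 (fun h => h (basis_vec R j)) (diff_comp df dg)).
rewrite -mulmxA -(deriveE_jacobian_mx _ df) -(deriveE_jacobian_mx _ dg) -E.
rewrite (@near_eq_derive _ _ _ _ id) // derive_id !mxE eqxx.
by rewrite andbT.
Qed.

Section Frames.
Variables (R : realType) (n : nat) (M : smoothManifold R n).

(** The transition maps are inverse to each other on the overlap only; this
    suffices for their differentials because the overlap is open. *)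
Lemma near_transitionK (c c' : chart R n M) (p : 'cV[R]_n) :
  cod c p -> dom c' (icoord c p) ->
  \near p, coord c (icoord c' (coord c' (icoord c p))) = p.
Proof.
move=> cp c'p.
have cont : {for p, continuous (icoord c)}.
  have := icoord_continuous (c := c); rewrite continuous_open_subspace.
    by apply; rewrite inE.
  exact: cod_open.
have near_dom : \near p, dom c' (icoord c p).
  apply: cont; apply: open_nbhs_nbhs; split; [exact: dom_open | exact: c'p].
have near_cod : \near p, cod c p.
  by apply: open_nbhs_nbhs; split; [exact: cod_open | exact: cp].
near=> q; rewrite coordK ?icoordK //; first by near: q.
by near: q.
Unshelve. all: by end_near. Qed.

Lemma jacobian_transitionK (c c' : chart R n M) (x : M) :
  atlas c -> atlas c' -> dom c x -> dom c' x ->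
  jacobian_mx (fun p => coord c (icoord c' p)) (coord c' x) *m
  jacobian_mx (fun p => coord c' (icoord c p)) (coord c x) = 1%:M.
Proof.
move=> ac ac' cx c'x.
have cxE : coord c' (icoord c (coord c x)) = coord c' x by rewrite coordK.
rewrite -{1}cxE; apply: jacobian_mx_comp_id.
- apply: (transition_smooth ac ac' [::]); split; first exact: coord_cod.
  by rewrite /= coordK.
- rewrite cxE; apply: (transition_smooth ac' ac [::]).
  by split; [exact: coord_cod | rewrite /= coordK].
- by apply: near_transitionK; [exact: coord_cod | rewrite coordK].
Qed.

(** On vectors this is the chain rule for the coordinate change and its
    inverse; on covectors it is the transpose of the same identity. *)
Lemma frame_changeK (c c' : chart R n M) (x : M) :
  atlas c -> atlas c' -> dom c x -> dom c' x ->
  frame_change c c' x *m frame_change c' c x = 1%:M.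
Proof.
move=> ac ac' cx c'x; rewrite mulmx_block !(mul0mx, mulmx0, addr0, add0r).
by rewrite -trmx_mul !jacobian_transitionK // trmx1 -scalar_mx_block.
Qed.

Definition endo_section (A : gendo M) (u : gsection M) : gsection M :=
  fun x => A x *m u x.

(** In a chart, the frame changes hidden in the components of A and of u
    cancel, so that the components of A u are a matrix product of smooth
    maps. *)
Lemma smooth_endo_section (A : gendo M) (u : gsection M) :
  smooth_endo A -> smooth_section u -> smooth_section (endo_section A u).
Proof.
move=> sA su c ac.
apply: (eq_smooth_on (@cod_open _ _ _ c) _
  (smooth_on_mulmx (@cod_open _ _ _ c) (sA c ac) (su c ac))).
move=> p cp; rewrite /endo_in_chart /section_in_chart /endo_section /=.
set x := icoord c p; rewrite -!mulmxA; congr (_ *m (_ *m _)).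
rewrite mulmxA frame_changeK ?mul1mx //.
- exact: chart_at_atlas.
- exact: icoord_dom.
- exact: chart_at_dom.
Qed.

Lemma smooth_endo_mulmx (A B : gendo M) :
  smooth_endo A -> smooth_endo B -> smooth_endo (fun x => A x *m B x).
Proof.
move=> sA sB c ac.
apply: (eq_smooth_on (@cod_open _ _ _ c) _
  (smooth_on_mulmx (@cod_open _ _ _ c) (sA c ac) (sB c ac))).
move=> p cp; rewrite /endo_in_chart /=.
set x := icoord c p; rewrite -!mulmxA; congr (_ *m (_ *m _)).
rewrite !mulmxA frame_changeK ?mul1mx //.
- exact: chart_at_atlas.
- exact: icoord_dom.
- exact: chart_at_dom.
Qed.

Lemma smooth_endo_lin (a b : R) (A B : gendo M) :
  smooth_endo A -> smooth_endo B -> smooth_endo (fun x => a *: A x + b *: B x).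
Proof.
move=> sA sB c ac.
have oc := @cod_open _ _ _ c.
have := smooth_onD oc (smooth_onZ oc a (sA c ac)) (smooth_onZ oc b (sB c ac)).
apply: (eq_smooth_on oc).
move=> p _; transitivity (a *: endo_in_chart c A p + b *: endo_in_chart c B p).
  by [].
rewrite /endo_in_chart mulmxDr mulmxDl.
by rewrite -!scalemxAr -!scalemxAl.
Qed.

Lemma section_in_chart_linear c (a : R) (u w : gsection M) :
  section_in_chart c (fun y => a *: u y + w y) =
  a *: section_in_chart c u + section_in_chart c w.
Proof.
apply/funext => p.
transitivity (a *: section_in_chart c u p + section_in_chart c w p); last by [].
by rewrite /section_in_chart mulmxDr -scalemxAr.
Qed.

Lemma smooth_section_lin (a : R) (u v : gsection M) :
  smooth_section u -> smooth_section v ->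
  smooth_section (fun x => a *: u x + v x).
Proof.
move=> su sv c ac; rewrite section_in_chart_linear.
have oc := @cod_open _ _ _ c.
exact: (smooth_onD oc (smooth_onZ oc a (su c ac)) (sv c ac)).
Qed.

End Frames.

(** * The Courant bracket in coordinates *)

Lemma derive_linear_dir (R : realType) (V W : normedModType R) (f : V -> W)
    (p : V) (a : R) (v w : V) :
  differentiable f p -> 'D_(a *: v + w) f p = a *: 'D_v f p + 'D_w f p.
Proof. by move=> df; rewrite !deriveE // linearP. Qed.

Lemma derive_linear (R : realType) (V W : normedModType R) (f g : V -> W)
    (p : V) (a : R) (v : V) :
  differentiable f p -> differentiable g p ->
  'D_v (a *: f + g) p = a *: 'D_v f p + 'D_v g p.
Proof.
move=> df dg; have dv h : differentiable h p -> derivable h p v.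
  exact: diff_derivable.
rewrite deriveD ?deriveZ //; first exact: dv.
  by apply: derivableZ; exact: dv.
exact: dv.
Qed.

Section Bracket.
Variables (R : realType) (n : nat).
Implicit Types (x y z : 'cV[R]_n) (u v w : 'cV[R]_n -> 'cV[R]_(n + n)).

Lemma eval_form_linearl (a : R) x y z :
  eval_form (a *: x + y) z = a * eval_form x z + eval_form y z.
Proof.
rewrite /eval_form mulr_sumr -big_split; apply: eq_bigr => i _ /=.
by rewrite !mxE mulrDl mulrA.
Qed.

Lemma eval_form_linearr (a : R) x y z :
  eval_form z (a *: x + y) = a * eval_form z x + eval_form z y.
Proof.
rewrite /eval_form mulr_sumr -big_split; apply: eq_bigr => i _ /=.
by rewrite !mxE mulrDr mulrCA.
Qed.

Lemma differentiable_eval_form (xi X : 'cV[R]_n -> 'cV[R]_n) p :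
  differentiable xi p -> differentiable X p ->
  differentiable (fun q => eval_form (xi q) (X q)) p.
Proof.
move=> /differentiable_mxP dxi /differentiable_mxP dX.
have -> : (fun q => eval_form (xi q) (X q)) =
    \sum_i ((fun q => xi q i 0) * (fun q => X q i 0)).
  by apply/funext => q; rewrite fct_sumE.
by apply: differentiable_sum => l; exact: differentiableM.
Qed.

Lemma differentiable_vec_part u p :
  differentiable u p -> differentiable (fun q => vec_part (u q)) p.
Proof.
move=> /differentiable_mxP du; apply/differentiable_mxP => i j.
have -> : (fun q => vec_part (u q) i j) = (fun q => u q (lshift n i) j).
  by apply/funext => q; rewrite mxE.
exact: du.
Qed.

Lemma differentiable_form_part u p :
  differentiable u p -> differentiable (fun q => form_part (u q)) p.
Proof.
move=> /differentiable_mxP du; apply/differentiable_mxP => i j.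
have -> : (fun q => form_part (u q) i j) = (fun q => u q (rshift n i) j).
  by apply/funext => q; rewrite mxE.
exact: du.
Qed.

Lemma lie_bracket_linear (a : R) (X X' Y : 'cV[R]_n -> 'cV[R]_n) p :
  differentiable X p -> differentiable X' p -> differentiable Y p ->
  lie_bracket (a *: X + X') Y p = a *: lie_bracket X Y p + lie_bracket X' Y p.
Proof.
move=> dX dX' dY; rewrite /lie_bracket derive_linear //.
rewrite -[(a *: X + X') p]/(a *: X p + X' p) derive_linear_dir //.
by rewrite scalerBr opprD addrACA.
Qed.

Lemma lie_form_linearl (a : R) (X X' eta : 'cV[R]_n -> 'cV[R]_n) p :
  differentiable X p -> differentiable X' p -> differentiable eta p ->
  lie_form (a *: X + X') eta p = a *: lie_form X eta p + lie_form X' eta p.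
Proof.
move=> dX dX' deta; rewrite /lie_form.
rewrite -[(a *: X + X') p]/(a *: X p + X' p) derive_linear_dir //.
rewrite scalerDr addrACA; congr (_ + _).
apply/colP => i; rewrite [LHS]mxE derive_linear // eval_form_linearr.
by rewrite !mxE.
Qed.

Lemma lie_form_linearr (a : R) (X xi xi' : 'cV[R]_n -> 'cV[R]_n) p :
  differentiable xi p -> differentiable xi' p ->
  lie_form X (a *: xi + xi') p = a *: lie_form X xi p + lie_form X xi' p.
Proof.
move=> dxi dxi'; rewrite /lie_form derive_linear //.
rewrite scalerDr addrACA; congr (_ + _).
apply/colP => i; rewrite [LHS]mxE.
rewrite -[(a *: xi + xi') p]/(a *: xi p + xi' p) eval_form_linearl.
by rewrite !mxE.
Qed.

Lemma ext_diff_linear (a : R) (f g : 'cV[R]_n -> R) p :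
  differentiable f p -> differentiable g p ->
  ext_diff (a *: f + g) p = a *: ext_diff f p + ext_diff g p.
Proof.
by move=> df dg; apply/colP => i; rewrite [LHS]mxE derive_linear // !mxE.
Qed.

(* eta(X) - xi(Y) for u = X + xi and v = Y + eta *)
Let skew u v q : R := eval_form (form_part (v q)) (vec_part (u q))
                      - eval_form (form_part (u q)) (vec_part (v q)).

Let differentiable_skew u v p :
  differentiable u p -> differentiable v p -> differentiable (skew u v) p.
Proof.
move=> du dv; apply: differentiableB; apply: differentiable_eval_form;
  by [exact: differentiable_vec_part | exact: differentiable_form_part].
Qed.

Lemma courant_bracket_localC u v p :
  differentiable u p -> differentiable v p ->
  courant_bracket_local u v p = - courant_bracket_local v u p.
Proof.
move=> du dv; rewrite /courant_bracket_local opp_col_mx.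
congr col_mx; first by rewrite /lie_bracket opprB.
have -> : ext_diff (skew u v) p = - ext_diff (skew v u) p.
  apply/colP => i; rewrite !mxE.
  have -> : skew u v = - skew v u.
    by apply/funext => q; rewrite -[RHS]/(- skew v u q) /skew opprB.
  by rewrite deriveN //; apply: diff_derivable; exact: differentiable_skew.
have swap (x y z : 'cV[R]_n) :
    x - y - 2^-1 *: (- z) = - (y - x - 2^-1 *: z).
  by rewrite scalerN opprK opprB opprB addrC.
exact: swap.
Qed.

Lemma courant_bracket_local_linear (a : R) u w v p :
  differentiable u p -> differentiable w p -> differentiable v p ->
  courant_bracket_local (a *: u + w) v p =
  a *: courant_bracket_local u v p + courant_bracket_local w v p.
Proof.
move=> du dw dv; rewrite /courant_bracket_local scale_col_mx add_col_mx.
have vecE : (fun q => vec_part ((a *: u + w) q)) =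
    a *: (fun q => vec_part (u q)) + (fun q => vec_part (w q)).
  by apply/funext => q; rewrite /vec_part linearP.
have formE : (fun q => form_part ((a *: u + w) q)) =
    a *: (fun q => form_part (u q)) + (fun q => form_part (w q)).
  by apply/funext => q; rewrite /form_part linearP.
have skewE : skew (a *: u + w) v = a *: skew u v + skew w v.
  apply/funext => q; rewrite -[RHS]/(a * skew u v q + skew w v q).
  rewrite /skew /vec_part /form_part !linearP.
  by rewrite eval_form_linearl eval_form_linearr /=; ring.
have [[dX dX'] dY] := (differentiable_vec_part du, differentiable_vec_part dw,
  differentiable_vec_part dv).
have [[dxi dxi'] deta] := (differentiable_form_part du,
  differentiable_form_part dw, differentiable_form_part dv).
rewrite vecE formE; congr col_mx.
  exact: lie_bracket_linear.
rewrite -[X in ext_diff X]/(skew (a *: u + w) v).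
rewrite -[X in a *: (_ - 2^-1 *: ext_diff X _)]/(skew u v).
rewrite -[X in _ + (_ - 2^-1 *: ext_diff X _)]/(skew w v) skewE.
rewrite lie_form_linearl // lie_form_linearr // ext_diff_linear;
  try exact: differentiable_skew.
have combine (x x' y y' z z' : 'cV[R]_n) :
    a *: x + x' - (a *: y + y') - 2^-1 *: (a *: z + z') =
    a *: (x - y - 2^-1 *: z) + (x' - y' - 2^-1 *: z').
  by apply/colP => i; rewrite !mxE; ring.
exact: combine.
Qed.

End Bracket.

(** * Trilinear forms on quaternionic modules *)

Section QuaternionicModule.
Variables (R : realFieldType) (V : lmodType R) (I J : {linear V -> V}).

Definition quaternionic : Prop :=
  [/\ forall x, I (I x) = - x, forall x, J (J x) = - x
    & forall x, J (I x) = - I (J x)].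

Definition lincomb (a b c : R) (x y z : V) : V := a *: x + b *: y + c *: z.

(** The action of the imaginary quaternion a I + b J + c K, with K = I J. *)
Definition imag (a b c : R) (x : V) : V := lincomb a b c (I x) (J x) (I (J x)).

Lemma imag_units (x : V) :
  (imag 1 0 0 x = I x) * (imag 0 1 0 x = J x) * (imag 0 0 1 x = I (J x)).
Proof. by rewrite /imag /lincomb !(scale1r, scale0r, addr0, add0r). Qed.

Hypothesis qIJ : quaternionic.

Lemma J_imag (a b c : R) (x : V) :
  J (imag a b c x) = lincomb (- a) (- b) c (I (J x)) x (I x).
Proof.
have [II JJ JI] := qIJ.
have JIJ : J (I (J x)) = I x by rewrite JI JJ linearN opprK.
by rewrite /imag /lincomb !linearD !linearZ /= JJ JI JIJ !scalerN !scaleNr.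
Qed.

Lemma I_imag (a b c : R) (x : V) :
  I (imag a b c x) = lincomb (- a) b (- c) x (I (J x)) (J x).
Proof.
have [II _ _] := qIJ.
by rewrite /imag /lincomb !linearD !linearZ /= !II !scalerN !scaleNr.
Qed.

Lemma IJ_imag (a b c : R) (x : V) :
  I (J (imag a b c x)) = lincomb a (- b) (- c) (J x) (I x) x.
Proof.
have [II _ _] := qIJ.
rewrite J_imag /lincomb !linearD !linearZ /= !II.
by rewrite !scalerN !scaleNr !opprK.
Qed.

Lemma imag_I (a b c : R) (x : V) :
  imag a b c (I x) = lincomb (- a) (- b) c x (I (J x)) (J x).
Proof.
have [II _ JI] := qIJ.
by rewrite /imag /lincomb II !JI !scalerN !scaleNr linearN /= II opprK.
Qed.

End QuaternionicModule.

Section Trilinear.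
Variable R : realFieldType.
Variables (V1 V2 V3 : lmodType R) (f : V1 -> V2 -> V3 -> R).

Definition trilinear : Prop :=
  [/\ forall a x x' y z, f (a *: x + x') y z = a * f x y z + f x' y z,
      forall a x y y' z, f x (a *: y + y') z = a * f x y z + f x y' z
    & forall a x y z z', f x y (a *: z + z') = a * f x y z + f x y z'].

Hypothesis tf : trilinear.

Lemma trilinear_lincomb :
  (forall a b c x x' x'' y z, f (lincomb a b c x x' x'') y z =
     a * f x y z + b * f x' y z + c * f x'' y z) *
  (forall a b c x y y' y'' z, f x (lincomb a b c y y' y'') z =
     a * f x y z + b * f x y' z + c * f x y'' z) *
  (forall a b c x y z z' z'', f x y (lincomb a b c z z' z'') =
     a * f x y z + b * f x y z' + c * f x y z'').
Proof.
have [t1 t2 t3] := tf.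
have f1 y z : f 0 y z = 0.
  by have := t1 (-1) 0 0 y z; rewrite scaler0 add0r => ->; ring.
have f2 x z : f x 0 z = 0.
  by have := t2 (-1) x 0 0 z; rewrite scaler0 add0r => ->; ring.
have f3 x y : f x y 0 = 0.
  by have := t3 (-1) x y 0 0; rewrite scaler0 add0r => ->; ring.
split; [split|] => a b c *; rewrite /lincomb -addrA -[c *: _]addr0.
- by rewrite !t1 f1 addr0 addrA.
- by rewrite !t2 f2 addr0 addrA.
- by rewrite !t3 f3 addr0 addrA.
Qed.

Variables (I1 J1 : {linear V1 -> V1}) (I2 J2 : {linear V2 -> V2})
  (I3 J3 : {linear V3 -> V3}).

(** The operator e_A for A = a I + b J + c K: the form f with A inserted in two
    of its three arguments, summed over the three choices.  On a joint
    eigenvector of the three actions of a unit A it is multiplication by 1 if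
    the eigenvalues are not all equal, and by -3 if they are. *)
Definition pairsum (a b c : R) (x : V1) (y : V2) (z : V3) : R :=
  f (imag I1 J1 a b c x) (imag I2 J2 a b c y) z +
  f (imag I1 J1 a b c x) y (imag I3 J3 a b c z) +
  f x (imag I2 J2 a b c y) (imag I3 J3 a b c z).

(** The sum of e_A over an orthonormal basis of the imaginary quaternions; up to
    an affine change this is the Casimir element of the diagonal action.  It is
    3 on the spin 1/2 part and -3 on the spin 3/2 part. *)
Definition casimir x y z :=
  pairsum 1 0 0 x y z + pairsum 0 1 0 x y z + pairsum 0 0 1 x y z.

Hypotheses (q1 : quaternionic I1 J1) (q2 : quaternionic I2 J2)
  (q3 : quaternionic I3 J3).

(** In operators: e_A Omega = |A|^2 (3 + Omega) - 3 e_A for Omega the Casimir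
    sum.  Let X run through the basis and write X A = - <A, X> + X x A.  Where
    X and A act on the same two arguments, the products sum to
    |A|^2 (3 + Omega) - e_A.  Where they share one argument only, the
    contributions of X x A cancel by antisymmetry and those of - <A, X> sum to
    - 2 e_A. *)
Lemma pairsum_casimir (a b c : R) x y z :
  casimir (imag I1 J1 a b c x) (imag I2 J2 a b c y) z +
  casimir (imag I1 J1 a b c x) y (imag I3 J3 a b c z) +
  casimir x (imag I2 J2 a b c y) (imag I3 J3 a b c z) =
  (a ^+ 2 + b ^+ 2 + c ^+ 2) * (3 * f x y z + casimir x y z)
  - 3 * pairsum a b c x y z.
Proof.
rewrite /casimir /pairsum !imag_units.
rewrite !(IJ_imag q1, IJ_imag q2, IJ_imag q3).
rewrite !(I_imag q1, I_imag q2, I_imag q3, J_imag q1, J_imag q2, J_imag q3).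
rewrite /imag !trilinear_lincomb.
ring.
Qed.

(** The anticommutator of e_I and e_A for A = a I + b J.  Where I and A act on
    the same two arguments, both receive the product of I and A, whence e_K.
    Where they share one argument only, the two orders add up to the
    anticommutator of I and A in that argument, a scalar, and leave I in one
    and A in the other of the remaining arguments.  These mixed terms are
    expressed here by e_A, e_I and e_J, since e_A is quadratic in A. *)
Lemma pairsum_anticomm (a b : R) x y z :
  pairsum 1 0 0 (imag I1 J1 a b 0 x) (imag I2 J2 a b 0 y) z +
  pairsum 1 0 0 (imag I1 J1 a b 0 x) y (imag I3 J3 a b 0 z) +
  pairsum 1 0 0 x (imag I2 J2 a b 0 y) (imag I3 J3 a b 0 z) +
  (pairsum a b 0 (I1 x) (I2 y) z + pairsum a b 0 (I1 x) y (I3 z) +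
   pairsum a b 0 x (I2 y) (I3 z)) =
  6 * a ^+ 2 * f x y z + 2 * b ^+ 2 * pairsum 0 0 1 x y z
  - 2 * a ^+ 2 * pairsum 1 0 0 x y z - 2 * pairsum a b 0 x y z
  + 2 * b ^+ 2 * pairsum 0 1 0 x y z.
Proof.
rewrite /pairsum !imag_units.
rewrite !(I_imag q1, I_imag q2, I_imag q3, imag_I q1, imag_I q2, imag_I q3).
rewrite /imag !trilinear_lincomb.
ring.
Qed.

(** If e_I f = e_A f = f, the anticommutator of e_I and e_A takes the value 2 on
    f, and the identity above becomes 4 b^2 f = 2 b^2 (e_J f + e_K f). *)
Lemma casimir_eq_of_pair (a b : R) :
  a ^+ 2 + b ^+ 2 = 1 -> b != 0 ->
  (forall x y z, pairsum 1 0 0 x y z = f x y z) ->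
  (forall x y z, pairsum a b 0 x y z = f x y z) ->
  forall x y z, casimir x y z = 3 * f x y z.
Proof.
move=> ab1 b0 eI eA x y z; have := pairsum_anticomm a b x y z.
rewrite !eI !eA -/(pairsum a b 0 x y z) eA.
have -> : f (I1 x) (I2 y) z + f (I1 x) y (I3 z) + f x (I2 y) (I3 z) = f x y z.
  by rewrite -(eI x y z) /pairsum !imag_units.
rewrite /casimir eI => E.
have a2 : a ^+ 2 = 1 - b ^+ 2 by rewrite -ab1; ring.
have b2 : b ^+ 2 != 0 by rewrite expf_neq0.
apply: (mulfI b2); move: E; rewrite a2 => E; lra.
Qed.

(** With Omega f = 3 f and |A| = 1, the identity e_A Omega = 3 + Omega - 3 e_A
    reads 3 e_A f = 6 f - 3 e_A f. *)
Lemma pairsum_eq_of_casimir (a b c : R) :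
  a ^+ 2 + b ^+ 2 + c ^+ 2 = 1 ->
  (forall x y z, casimir x y z = 3 * f x y z) ->
  forall x y z, pairsum a b c x y z = f x y z.
Proof.
move=> abc1 eC x y z; have := pairsum_casimir a b c x y z.
rewrite !eC abc1 -2!mulrDr -/(pairsum a b c x y z) => E; lra.
Qed.

End Trilinear.

(** * Smooth sections and the bracket as a trilinear form *)

Section Sections.
Variables (R : realType) (n : nat) (M : smoothManifold R n).

Lemma courant_bracketC (u v : gsection M) x :
  smooth_section u -> smooth_section v ->
  courant_bracket u v x = - courant_bracket v u x.
Proof.
move=> su sv; apply: courant_bracket_localC.
  by apply: (su _ (chart_at_atlas x) [::]); exact/coord_cod/chart_at_dom.
by apply: (sv _ (chart_at_atlas x) [::]); exact/coord_cod/chart_at_dom.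
Qed.

Lemma courant_bracket_linear (a : R) (u w v : gsection M) x :
  smooth_section u -> smooth_section w -> smooth_section v ->
  courant_bracket (fun y => a *: u y + w y) v x =
  a *: courant_bracket u v x + courant_bracket w v x.
Proof.
move=> su sw sv.
have d (s : gsection M) : smooth_section s ->
    differentiable (section_in_chart (chart_at x) s) (coord (chart_at x) x).
  move=> ss; apply: (ss _ (chart_at_atlas x) [::]).
  exact/coord_cod/chart_at_dom.
rewrite /courant_bracket section_in_chart_linear.
by rewrite courant_bracket_local_linear; try exact: d.
Qed.

Definition smooth_sections : {pred M -> 'cV[R]_(n + n)} :=
  fun u => `[< smooth_section (u : gsection M) >].

Lemma smooth_section0 : smooth_section (fun _ : M => 0).
Proof.
move=> c _; have -> : section_in_chart c (fun _ : M => 0) = cst 0.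
  by apply/funext => p; rewrite /section_in_chart mulmx0.
have cst0 (vs : seq 'cV[R]_n) :
    foldr (fun v (g : 'cV[R]_n -> 'cV[R]_(n + n)) => 'D_v g) (cst 0) vs = cst 0.
  by elim: vs => //= v vs ->; apply/funext => p; rewrite derive_cst.
by move=> vs p _; rewrite cst0.
Qed.

Lemma smooth_sections_submod_closed : submod_closed smooth_sections.
Proof.
split; first exact/asboolP/smooth_section0.
move=> a u v /asboolP su /asboolP sv; apply/asboolP.
exact: smooth_section_lin.
Qed.

HB.instance Definition _ :=
  GRing.isSubmodClosed.Build R (M -> 'cV[R]_(n + n)) smooth_sections
    smooth_sections_submod_closed.

(** Bundling the smooth sections into a real vector space lets the bracket at a
    point be treated as a trilinear form without smoothness side
    conditions. *)
Record smoothSection := SmoothSection {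
  smooth_val :> M -> 'cV[R]_(n + n);
  smooth_val_subproof : smooth_val \in smooth_sections }.

HB.instance Definition _ := [isSub for smooth_val].
HB.instance Definition _ := [Choice of smoothSection by <:].
HB.instance Definition _ := [SubChoice_isSubLmodule of smoothSection by <:].

Lemma smooth_sectionP (u : smoothSection) : smooth_section u.
Proof. by have /asboolP := smooth_val_subproof u. Qed.

Section Apply.
Variables (A : gendo M) (sA : smooth_endo A).

Definition endo_apply (u : smoothSection) : smoothSection :=
  SmoothSection
    (introT (asboolP _) (smooth_endo_section sA (smooth_sectionP u))).

Lemma endo_apply_linear : linear endo_apply.
Proof.
move=> a u v; apply: val_inj; apply/funext => x.
transitivity (A x *m (a *: u x + v x)); first by [].
by rewrite mulmxDr -scalemxAr.
Qed.

HB.instance Definition _ :=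
  GRing.isLinear.Build R smoothSection smoothSection _ endo_apply
    endo_apply_linear.

End Apply.

(** Evaluation on all covectors phi loses nothing and makes the form
    scalar-valued, so that its three arguments play the same part. *)
Definition bracket_form (x : M) (phi : 'rV[R]_(n + n))
    (u v : smoothSection) : R :=
  (phi *m courant_bracket u v x) 0 0.

Lemma bracket_form_trilinear (x : M) : trilinear (bracket_form x).
Proof.
have lin (a : R) (y z : 'M[R]_1) : (a *: y + z) 0 0 = a * y 0 0 + z 0 0.
  by rewrite !mxE.
have linl (a : R) (u u' v : smoothSection) :
    courant_bracket (a *: u + u') v x =
    a *: courant_bracket u v x + courant_bracket u' v x.
  by apply: courant_bracket_linear; exact: smooth_sectionP.
have anti (u v : smoothSection) :
    courant_bracket u v x = - courant_bracket v u x.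
  by apply: courant_bracketC; exact: smooth_sectionP.
have linr (a : R) (u v v' : smoothSection) :
    courant_bracket u (a *: v + v') x =
    a *: courant_bracket u v x + courant_bracket u v' x.
  rewrite (anti u (a *: v + v')) linl (anti u v) (anti u v').
  by rewrite opprD scalerN.
split=> a; rewrite /bracket_form.
- by move=> p p' u v; rewrite mulmxDl -scalemxAl lin.
- by move=> p u u' v; rewrite linl mulmxDr -scalemxAr lin.
- by move=> p u v v'; rewrite linr mulmxDr -scalemxAr lin.
Qed.

End Sections.

(** * Integrability as a condition on real sections *)

Section Integrability.
Variables (R : realType) (n : nat) (M : smoothManifold R n).

Definition cplx_section (a b : gsection M) : csection M :=
  fun x => \col_k Complex (a x k 0) (b x k 0).

Lemma re_cplx_section (a b : gsection M) : re_section (cplx_section a b) = a.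
Proof. by apply/funext => x; apply/colP => k; rewrite !mxE. Qed.

Lemma im_cplx_section (a b : gsection M) : im_section (cplx_section a b) = b.
Proof. by apply/funext => x; apply/colP => k; rewrite !mxE. Qed.

Lemma cplx_sectionE (u : csection M) :
  u = cplx_section (re_section u) (im_section u).
Proof.
by apply/funext => x; apply/colP => k; rewrite !mxE; case: (u x k 0).
Qed.

(** For A^2 = - 1 the second equation follows from the first, so the sections
    of the eigenbundle are the u - i A u with u real. *)
Lemma in_i_eigenbundleP (A : gendo M) (a b : gsection M) :
  in_i_eigenbundle A (cplx_section a b) <->
  forall x, A x *m a x = - b x /\ A x *m b x = a x.
Proof.
have sumE (I : finType) (F G : I -> R) :
    \sum_i Complex (F i) (G i) = Complex (\sum_i F i) (\sum_i G i).
  by elim/big_rec3: _ => // i y1 y2 y3 _ ->.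
have lhs x k : (map_mx (real_complex R) (A x) *m cplx_section a b x) k 0 =
    Complex ((A x *m a x) k 0) ((A x *m b x) k 0).
  rewrite !mxE -sumE; apply: eq_bigr => l _; rewrite !mxE.
  by congr Complex; rewrite /= mul0r ?subr0 ?addr0.
have rhs x k : ('i%C *: cplx_section a b x) k 0 = Complex (- b x k 0) (a x k 0).
  by rewrite !mxE; congr Complex; rewrite /= !mul0r mul1r ?sub0r ?add0r.
split=> [e x | e x].
  split; apply/colP => k; have /colP /(_ k) := e x; rewrite lhs rhs => -[].
    by move=> -> _; rewrite [RHS]mxE.
  by move=> _ ->.
have [ea eb] := e x.
by apply/colP => k; rewrite lhs rhs ea eb [in LHS]mxE.
Qed.

Lemma courant_bracketNl (u v : smoothSection M) x :
  courant_bracket (fun y => - u y) v x = - courant_bracket u v x.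
Proof.
have lin (a : R) (w : smoothSection M) :
    courant_bracket (fun y => a *: u y + w y) v x =
    a *: courant_bracket u v x + courant_bracket w v x.
  by apply: courant_bracket_linear; exact: smooth_sectionP.
have N1 : courant_bracket (fun y => -1 *: u y + u y) v x = 0.
  by rewrite lin scaleN1r addNr.
have -> : (fun y => - u y) =
    fun y => -1 *: u y + (-1 *: u + u : smoothSection M) y.
  apply/funext => y; transitivity (-1 *: u y + (-1 *: u y + u y)); last by [].
  by rewrite !scaleN1r addNr addr0.
by rewrite lin N1 addr0 scaleN1r.
Qed.

Lemma courant_bracketNr (u v : smoothSection M) x :
  courant_bracket u (fun y => - v y) x = - courant_bracket u v x.
Proof.
have sN : smooth_section (fun y : M => - v y) := smooth_sectionP (- v).
rewrite (courant_bracketC x (smooth_sectionP u) sN) courant_bracketNl.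
by rewrite (courant_bracketC x (smooth_sectionP u) (smooth_sectionP v)).
Qed.

(** The bracket of u - i A u and v - i A v has real part [u, v] - [A u, A v] and
    imaginary part - [A u, v] - [u, A v].  It lies in the eigenbundle exactly
    when A maps the real part to minus the imaginary part: this is the
    vanishing of the Nijenhuis tensor of A on global smooth sections. *)
Lemma integrableP (A : gendo M) (sA : smooth_endo A) :
  (forall x, A x *m A x = - 1%:M) ->
  integrable A <-> forall x (u v : smoothSection M),
    A x *m (courant_bracket u v x
            - courant_bracket (endo_apply sA u) (endo_apply sA v) x) =
    courant_bracket (endo_apply sA u) v x
    + courant_bracket u (endo_apply sA v) x.
Proof.
move=> A2.
have AA w x : A x *m (A x *m w) = - w by rewrite mulmxA A2 mulNmx mul1mx.
pose eig (u : smoothSection M) := cplx_section u (fun x => - endo_apply sA u x).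
have smooth_eig u : smooth_csection (eig u).
  rewrite /smooth_csection re_cplx_section im_cplx_section.
  split; first exact: smooth_sectionP.
  exact: (smooth_sectionP (- endo_apply sA u)).
have eigen u : in_i_eigenbundle A (eig u).
  by apply/in_i_eigenbundleP => x; rewrite opprK mulmxN AA opprK.
have bracketE u v : ccourant_bracket (eig u) (eig v) =
    cplx_section
      (fun x => courant_bracket u v x
                - courant_bracket (endo_apply sA u) (endo_apply sA v) x)
      (fun x => - (courant_bracket (endo_apply sA u) v x
                   + courant_bracket u (endo_apply sA v) x)).
  rewrite /ccourant_bracket !re_cplx_section !im_cplx_section.
  apply/funext => x.
  have NN : courant_bracket (fun y => - endo_apply sA u y)
        (fun y => - endo_apply sA v y) x
      = courant_bracket (endo_apply sA u) (endo_apply sA v) x.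
    rewrite (courant_bracketNl _ (- endo_apply sA v)).
    by rewrite courant_bracketNr opprK.
  have NI : courant_bracket u (fun y => - endo_apply sA v y) x
      + courant_bracket (fun y => - endo_apply sA u y) v x
      = - (courant_bracket (endo_apply sA u) v x
           + courant_bracket u (endo_apply sA v) x).
    have swap (y z : 'cV[R]_(n + n)) : - y + - z = - (z + y).
      by rewrite opprD addrC.
    by rewrite courant_bracketNl courant_bracketNr; exact: swap.
  pose cplx (y z : 'cV[R]_(n + n)) := \col_k Complex (y k 0) (z k 0).
  have E1 := congr1 (fun z => courant_bracket u v x - z) NN.
  have E2 := f_equal2 cplx E1 NI.
  exact: E2.
split=> [iA x u v | N s t ss st es et].
  have := iA _ _ (smooth_eig u) (smooth_eig v) (eigen u) (eigen v).
  by rewrite bracketE => /in_i_eigenbundleP /(_ x) [+ _]; rewrite opprK.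
have eig_eq (a : csection M) : smooth_csection a ->
    in_i_eigenbundle A a -> exists u, a = eig u.
  move=> [sa1 _] ea1.
  exists (SmoothSection (introT (asboolP (smooth_section (re_section a))) sa1)).
  rewrite {1}(cplx_sectionE a); congr cplx_section; apply/funext => x.
  move: ea1; rewrite {1}(cplx_sectionE a) => /in_i_eigenbundleP /(_ x) [e _].
  by rewrite -[RHS]/(- (A x *m re_section a x)) e opprK.
have [u ->] := eig_eq s ss es; have [v ->] := eig_eq t st et.
rewrite bracketE; apply/in_i_eigenbundleP => x; rewrite opprK N; split=> //.
by rewrite -N mulmxN AA opprK.
Qed.

(** Applying A to the vanishing of the Nijenhuis tensor and pairing with phi
    turns it into e_A tau = tau: the covector A . phi is - phi A. *)
Lemma integrable_bracket_form (A : gendo M) (sA : smooth_endo A) :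
  (forall x, A x *m A x = - 1%:M) ->
  integrable A <-> forall x phi (u v : smoothSection M),
    bracket_form x (phi *m - A x) (endo_apply sA u) v +
    bracket_form x (phi *m - A x) u (endo_apply sA v) +
    bracket_form x phi (endo_apply sA u) (endo_apply sA v) =
    bracket_form x phi u v.
Proof.
move=> A2; rewrite (integrableP sA A2).
have formP (B : 'M[R]_(n + n)) (b bl br blr : 'cV[R]_(n + n)) :
    B *m B = - 1%:M ->
    B *m (b - blr) = bl + br <->
    forall phi : 'rV[R]_(n + n), (phi *m - B *m bl) 0 0
      + (phi *m - B *m br) 0 0 + (phi *m blr) 0 0 = (phi *m b) 0 0.
  move=> B2; have BB w : B *m (B *m w) = - w by rewrite mulmxA B2 mulNmx mul1mx.
  have formE (phi : 'rV[R]_(n + n)) : (phi *m - B *m bl) 0 0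
      + (phi *m - B *m br) 0 0 + (phi *m blr) 0 0
      = (phi *m (blr - B *m (bl + br))) 0 0.
    rewrite mulmxBr mulmxDr mulmxDr !mulmxN !mulNmx !mulmxA opprD.
    by move: (_ *m bl) (_ *m br) (_ *m blr) => y z t; rewrite !mxE; ring.
  split=> [e phi | e].
    by rewrite formE -e BB opprK addrC subrK.
  have {}e : blr - B *m (bl + br) = b.
    apply/colP => k; have := e (delta_mx 0 k).
    by rewrite formE -!rowE [LHS]mxE [RHS]mxE.
  by rewrite -e addrAC subrr add0r mulmxN BB opprK.
split=> N x; first by move=> phi u v; move: phi; apply/(formP _ _ _ _ _ (A2 x)).
by move=> u v; apply/(formP _ _ _ _ _ (A2 x)) => phi; exact: (N x phi u v).
Qed.

End Integrability.

(** * Integrability along the sphere *)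

Section Sphere.
Variables (R : realType) (n : nat) (M : smoothManifold R n).

Definition sphere_endo (I J : gendo M) (a b c : R) : gendo M :=
  fun x => a *: I x + b *: J x + c *: (I x *m J x).

Variables (I J : gendo M) (sI : smooth_endo I) (sJ : smooth_endo J).
Hypotheses (I2 : forall x, I x *m I x = - 1%:M)
  (J2 : forall x, J x *m J x = - 1%:M) (IJ : anticommute I J).

Lemma smooth_sphere_endo (a b c : R) : smooth_endo (sphere_endo I J a b c).
Proof.
have sab := smooth_endo_lin a b sI sJ.
have := smooth_endo_lin 1 c sab (smooth_endo_mulmx sI sJ).
by congr smooth_endo; apply/funext => x; rewrite scale1r.
Qed.

Let rI x := mulmxr (- I x) : {linear 'rV[R]_(n + n) -> 'rV[R]_(n + n)}.
Let rJ x := mulmxr (- J x) : {linear 'rV[R]_(n + n) -> 'rV[R]_(n + n)}.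

(** The sign turns right multiplication, which reverses products, into a left
    action of the quaternions. *)
Lemma quaternionic_covector x : quaternionic (rI x) (rJ x).
Proof.
have NN (B C : 'M[R]_(n + n)) : - B *m - C = B *m C.
  by rewrite mulNmx mulmxN opprK.
split=> phi /=.
- by rewrite -mulmxA NN I2 mulmxN mulmx1.
- by rewrite -mulmxA NN J2 mulmxN mulmx1.
- by rewrite -!mulmxA !NN IJ mulmxN.
Qed.

Lemma quaternionic_section :
  quaternionic (endo_apply sI : {linear smoothSection M -> smoothSection M})
    (endo_apply sJ).
Proof.
split=> u; apply: val_inj; apply/funext => x.
- transitivity (I x *m (I x *m u x)); first by [].
  by rewrite mulmxA I2 mulNmx mul1mx.
- transitivity (J x *m (J x *m u x)); first by [].
  by rewrite mulmxA J2 mulNmx mul1mx.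
- transitivity (J x *m (I x *m u x)); first by [].
  transitivity (- (I x *m (J x *m u x))); last by [].
  by rewrite !mulmxA IJ mulNmx opprK.
Qed.

Lemma sphere_anticommutator x (a b c a' b' c' : R) :
  sphere_endo I J a b c x *m sphere_endo I J a' b' c' x +
  sphere_endo I J a' b' c' x *m sphere_endo I J a b c x =
  (- (2 * (a * a' + b * b' + c * c')))%:M.
Proof.
rewrite /sphere_endo; set K := I x *m J x.
have II := I2 x; have JJ := J2 x; have JI : J x *m I x = - K.
  by rewrite /K IJ opprK.
have IK : I x *m K = - J x by rewrite /K mulmxA II mulNmx mul1mx.
have KJ : K *m J x = - I x by rewrite /K -mulmxA JJ mulmxN mulmx1.
have KI : K *m I x = J x by rewrite /K -mulmxA JI mulmxN IK opprK.
have JK : J x *m K = I x by rewrite /K mulmxA JI mulNmx KJ opprK.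
have KK : K *m K = - 1%:M by rewrite {2}/K mulmxA KI JJ.
rewrite !(mulmxDl, mulmxDr) -!(scalemxAl, scalemxAr).
rewrite II JJ KK JI IK KJ KI JK -/K.
by apply/matrixP => i j; rewrite !mxE; ring.
Qed.

Lemma sphere_sq x (a b c : R) : a ^+ 2 + b ^+ 2 + c ^+ 2 = 1 ->
  sphere_endo I J a b c x *m sphere_endo I J a b c x = - 1%:M.
Proof.
move=> abc1; have := sphere_anticommutator x a b c a b c.
rewrite -!expr2 abc1 mulr1 => E.
apply: (scalerI (_ : 2 != 0 :> R)); first by rewrite pnatr_eq0.
by rewrite scaler_nat mulr2n E scalerN raddfN /= scale_scalar_mx mulr1.
Qed.

Lemma integrable_sphere_endoP (a b c : R) : a ^+ 2 + b ^+ 2 + c ^+ 2 = 1 ->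
  integrable (sphere_endo I J a b c) <-> forall x phi u v,
    pairsum (bracket_form x) (rI x) (rJ x) (endo_apply sI) (endo_apply sJ)
      (endo_apply sI) (endo_apply sJ) a b c phi u v = bracket_form x phi u v.
Proof.
move=> abc1; rewrite (integrable_bracket_form (smooth_sphere_endo a b c));
  last by move=> x; exact: sphere_sq.
have secE u : endo_apply (smooth_sphere_endo a b c) u =
    imag (endo_apply sI) (endo_apply sJ) a b c u.
  apply: val_inj; apply/funext => x.
  transitivity (a *: (I x *m u x) + b *: (J x *m u x)
                + c *: (I x *m (J x *m u x))); last by [].
  rewrite -[LHS]/(sphere_endo I J a b c x *m u x) /sphere_endo.
  by rewrite !mulmxDl -!scalemxAl mulmxA.
have covE x phi : phi *m - sphere_endo I J a b c x =
    imag (rI x) (rJ x) a b c phi.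
  rewrite /imag /lincomb /=.
  have -> : phi *m - J x *m - I x = phi *m - (I x *m J x).
    by rewrite -mulmxA mulmxN mulNmx opprK IJ opprK.
  rewrite /sphere_endo !mulmxN !mulmxDr -!scalemxAr.
  by rewrite !opprD !scalerN.
by split=> N x phi u v; have := N x phi u v; rewrite /pairsum !secE covE.
Qed.

(** The pair I, A = a I + b J fixes the Casimir value of the bracket form at
    each point, and that value makes every member of the sphere integrable.  In
    weights: a binary cubic with the roots I, - I, A and - A vanishes, and
    b <> 0 keeps these roots distinct. *)
Lemma integrable_sphere (a b x y z : R) :
  a ^+ 2 + b ^+ 2 = 1 -> b != 0 ->
  integrable I -> integrable (sphere_endo I J a b 0) ->
  x ^+ 2 + y ^+ 2 + z ^+ 2 = 1 -> integrable (sphere_endo I J x y z).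
Proof.
move=> ab1 b0 intI intA xyz1.
have c100 : (1 : R) ^+ 2 + 0 ^+ 2 + 0 ^+ 2 = 1 by rewrite expr1n expr0n !addr0.
have cab0 : a ^+ 2 + b ^+ 2 + 0 ^+ 2 = 1 by rewrite ab1 expr0n addr0.
have IE : I = sphere_endo I J 1 0 0.
  by apply/funext => w; rewrite /sphere_endo scale1r !scale0r !addr0.
rewrite IE in intI.
move: intI => /(integrable_sphere_endoP c100) eI.
move: intA => /(integrable_sphere_endoP cab0) eA.
apply/(integrable_sphere_endoP xyz1) => w.
apply: pairsum_eq_of_casimir => //; try exact: bracket_form_trilinear.
- exact: quaternionic_covector.
- exact: quaternionic_section.
- exact: quaternionic_section.
apply: (casimir_eq_of_pair _ _ _ _ ab1 b0 (eI w) (eA w)).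
- exact: bracket_form_trilinear.
- exact: quaternionic_covector.
- exact: quaternionic_section.
- exact: quaternionic_section.
Qed.

End Sphere.

(** * The almost hypercomplex structure *)

Section Pairing.
Variables (R : realType) (n : nat).
Implicit Types (u v w : 'cV[R]_(n + n)) (A B : 'M[R]_(n + n)).

Lemma pairing_linearl (a : R) u v w :
  pairing (a *: u + v) w = a * pairing u w + pairing v w.
Proof.
rewrite /pairing /vec_part /form_part !linearP /= eval_form_linearl.
by rewrite eval_form_linearr; ring.
Qed.

Lemma pairingC u v : pairing u v = pairing v u.
Proof. by rewrite /pairing addrC. Qed.

Lemma pairing_linearr (a : R) u v w :
  pairing w (a *: u + v) = a * pairing w u + pairing w v.
Proof. by rewrite !(pairingC w) pairing_linearl. Qed.

Lemma pairing_Zl (a : R) u v : pairing (a *: u) v = a * pairing u v.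
Proof.
have := pairing_linearl (-1) u u v.
rewrite scaleN1r addNr mulN1r addNr => p0.
by rewrite -[a *: u]addr0 pairing_linearl p0 addr0.
Qed.

Lemma pairing_Nl u v : pairing (- u) v = - pairing u v.
Proof. by rewrite -scaleN1r pairing_Zl mulN1r. Qed.

Definition skew_adjoint A : Prop :=
  forall u v, pairing (A *m u) v = - pairing u (A *m v).

(** Unlike orthogonality, skew-adjointness is a linear condition, which is what
    makes it pass to the members of a sphere family. *)
Lemma orthogonal_skewP A : A *m A = - 1%:M ->
  (forall u v, pairing (A *m u) (A *m v) = pairing u v) <-> skew_adjoint A.
Proof.
move=> A2; have AA u : A *m (A *m u) = - u by rewrite mulmxA A2 mulNmx mul1mx.
split=> h u v; first by rewrite -h AA pairing_Nl.
by rewrite h AA pairingC pairing_Nl opprK pairingC.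
Qed.

Lemma skew_adjoint_lin (a b : R) A B :
  skew_adjoint A -> skew_adjoint B -> skew_adjoint (a *: A + b *: B).
Proof.
move=> sA sB u v; rewrite !mulmxDl -!scalemxAl.
rewrite pairing_linearl pairing_Zl sA sB pairing_linearr.
by rewrite (pairingC u (b *: _)) pairing_Zl (pairingC _ u); ring.
Qed.

End Pairing.

Section AlmostComplex.
Variables (R : realType) (n : nat) (M : smoothManifold R n).

Lemma gen_almost_complex_mul (I J : gendo M) :
  gen_almost_complex I -> gen_almost_complex J -> anticommute I J ->
  gen_almost_complex (fun x => I x *m J x).
Proof.
move=> [sI I2 oI] [sJ J2 oJ] IJ; split; first exact: smooth_endo_mulmx.
  move=> x; rewrite {1}IJ mulNmx !mulmxA -[_ *m I x *m I x]mulmxA I2 mulmxN.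
  by rewrite mulmx1 mulNmx J2 opprK.
by move=> x u v; rewrite -!mulmxA oI oJ.
Qed.

Lemma gen_almost_complex_sphere (I J : gendo M) (a b c : R) :
  gen_almost_complex I -> gen_almost_complex J -> anticommute I J ->
  a ^+ 2 + b ^+ 2 + c ^+ 2 = 1 -> gen_almost_complex (sphere_endo I J a b c).
Proof.
move=> gI gJ IJ abc1; have [_ K2 oK] := gen_almost_complex_mul gI gJ IJ.
have [[sI I2 oI] [sJ J2 oJ]] := conj gI gJ.
have sq := sphere_sq I2 J2 IJ _ abc1.
split; [exact: smooth_sphere_endo | exact: sq |] => x.
apply/(orthogonal_skewP (sq x)); rewrite /sphere_endo -[_ + b *: _]scale1r.
apply: skew_adjoint_lin; last exact/(orthogonal_skewP (K2 x)).
by apply: skew_adjoint_lin; exact/orthogonal_skewP.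
Qed.

Lemma sphere_family_mul (I J : gendo M) :
  sphere_family I J (fun x => I x *m J x) =
  [set A | exists a b c : R, a ^+ 2 + b ^+ 2 + c ^+ 2 = 1 /\
     A = sphere_endo I J a b c]%classic.
Proof.
apply/seteqP; split=> A [a [b [c [abc1 AE]]]]; exists a, b, c; split=> //.
  exact/funext.
by move=> x; rewrite AE.
Qed.

End AlmostComplex.

(** The equality case of Cauchy-Schwarz: the vector v' - d v, where d is the
    scalar product of the unit vectors v and v', has square norm 1 - d^2. *)
Lemma unit_vectors_dot_lt1 (R : realFieldType) (a b c a' b' c' : R) :
  a ^+ 2 + b ^+ 2 + c ^+ 2 = 1 -> a' ^+ 2 + b' ^+ 2 + c' ^+ 2 = 1 ->
  let d := a * a' + b * b' + c * c' in
  `|d| < 1 \/ exists e : bool,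
     [/\ a' = (-1) ^+ e * a, b' = (-1) ^+ e * b & c' = (-1) ^+ e * c].
Proof.
move=> n1 n1' d.
have key : (a' - d * a) ^+ 2 + (b' - d * b) ^+ 2 + (c' - d * c) ^+ 2
    = 1 - d ^+ 2.
  transitivity (1 * (a' ^+ 2 + b' ^+ 2 + c' ^+ 2)
      + d ^+ 2 * (a ^+ 2 + b ^+ 2 + c ^+ 2) - 2 * d * d).
    by rewrite /d; ring.
  by rewrite n1 n1'; ring.
have [d1|d1] := ltP `|d| 1; [by left | right].
have d2 : 1 <= d ^+ 2 by rewrite -real_normK ?num_real // expr_ge1.
have ge0 := (sqr_ge0 (a' - d * a), sqr_ge0 (b' - d * b), sqr_ge0 (c' - d * c)).
have [[a0 b0] c0] : ((a' - d * a) ^+ 2 = 0 /\ (b' - d * b) ^+ 2 = 0)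
    /\ (c' - d * c) ^+ 2 = 0.
  by case: ge0 => [[? ?] ?]; split; [split|]; lra.
have dd : d ^+ 2 = 1 by move: key; rewrite a0 b0 c0 => ?; lra.
have sub z t : (z - d * t) ^+ 2 = 0 -> z = d * t.
  by move=> /eqP; rewrite sqrf_eq0 subr_eq0 => /eqP.
move: dd => /eqP; rewrite sqrf_eq1 => /orP[] /eqP dE.
  by exists false; rewrite expr0 -dE; split; exact: sub.
by exists true; rewrite expr1 -dE; split; exact: sub.
Qed.

Theorem theorem4p3 (R : realType) (n : nat) (M : smoothManifold R n)
    (I1 I2 : gendo M)
    (hI1 : gen_complex I1) (hI2 : gen_complex I2)
    (hneq : I1 <> I2) (hneqN : I1 <> (fun x => - I2 x)) :
  part_of_hypercomplex_family I1 I2 <->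
  exists p : R, `|p| < 1 /\
    forall x : M, I1 x *m I2 x + I2 x *m I1 x = (2 * p)%:M.
Proof.
split.
  move=> [I [J [K [[[[gI gJ _] [IJ _ _ KE]] _] []]]]].
  have -> : K = fun x => I x *m J x by exact/funext.
  rewrite sphere_family_mul => -[a [b [c [n1 E1]]]] [a' [b' [c' [n1' E2]]]].
  have [[_ sqI _] [_ sqJ _]] := conj gI gJ.
  exists (- (a * a' + b * b' + c * c')); split; last first.
    by move=> x; rewrite E1 E2 sphere_anticommutator // mulrN.
  rewrite normrN; have [//|[e [a'E b'E c'E]]] := unit_vectors_dot_lt1 n1 n1'.
  have E21 x : I2 x = (-1) ^+ e *: I1 x.
    rewrite E1 E2 a'E b'E c'E /sphere_endo -!scalerA -!scalerDr.
    by [].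
  case: e E21 {a'E b'E c'E} => E21.
    by case: hneqN; apply/funext => x; rewrite E21 scaleN1r opprK.
  by case: hneq; apply/funext => x; rewrite E21 scale1r.
move=> [p [p1 pE]].
have [[g1 int1] [g2 int2]] := conj hI1 hI2.
have [[s1 sq1 o1] [s2 sq2 o2]] := conj g1 g2.
have p2 : 0 < 1 - p ^+ 2.
  by rewrite subr_gt0 -real_normK ?num_real // exprn_ilt1.
pose s := Num.sqrt (1 - p ^+ 2).
have s2E : s ^+ 2 = 1 - p ^+ 2 by rewrite sqr_sqrtr // ltW.
have s0 : s != 0 by rewrite gt_eqF // sqrtr_gt0.
(* normalised component of I2 orthogonal to I1: <I1, I2> = - p *)
pose J : gendo M := fun x => (p / s) *: I1 x + s^-1 *: I2 x.
have sJ : smooth_endo J := smooth_endo_lin (p / s) s^-1 s1 s2.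
have I21 x : I2 x *m I1 x = (2 * p)%:M - I1 x *m I2 x.
  by rewrite -(pE x) addrAC subrr add0r.
have sqJ x : J x *m J x = - 1%:M.
  rewrite /J !(mulmxDl, mulmxDr) -!(scalemxAl, scalemxAr) I21 sq1 sq2.
  move: (I1 x *m I2 x) => K; apply/matrixP => i j; rewrite !mxE.
  move: (_ == _) => d; transitivity (- (s ^- 2 * (1 - p ^+ 2)) *+ d).
    by rewrite -exprVn; case: d; rewrite ?mulr1n ?mulr0n; ring.
  by rewrite -s2E mulVf ?expf_neq0 // mulNrn.
have IJ : anticommute I1 J.
  move=> x; rewrite /J mulmxDl mulmxDr -!(scalemxAl, scalemxAr) I21 sq1.
  by move: (I1 x *m I2 x) => K; apply/matrixP => i j; rewrite !mxE; ring.
have gJ : gen_almost_complex J.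
  split=> // x; apply/(orthogonal_skewP (sqJ x)).
  by apply: skew_adjoint_lin; exact/orthogonal_skewP.
have I2E : I2 = sphere_endo I1 J (- p) s 0.
  apply/funext => x; rewrite /sphere_endo /J scale0r addr0 scalerDr !scalerA.
  by rewrite mulfV // scale1r mulrCA mulfV // mulr1 scaleNr addKr.
have ps1 : (- p) ^+ 2 + s ^+ 2 = 1 by rewrite sqrrN s2E addrC subrK.
exists I1, J, (fun x => I1 x *m J x); split; last split.
- split.
    split; first by split=> //; exact: gen_almost_complex_mul.
    split=> // x.
      by rewrite mulmxA IJ mulNmx opprK.
    by rewrite {1}IJ mulmxN mulmxA.
  rewrite sphere_family_mul => _ [a [b [c [abc1 ->]]]].
  split; first exact: gen_almost_complex_sphere.
  by apply: (integrable_sphere s1 sJ sq1 sqJ IJ ps1 s0) => //; rewrite -I2E.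
- rewrite sphere_family_mul; exists 1, 0, 0; split.
    by rewrite expr1n expr0n !addr0.
  by apply/funext => x; rewrite /sphere_endo scale1r !scale0r !addr0.
- rewrite sphere_family_mul; exists (- p), s, 0; split=> //.
  by rewrite ps1 expr0n addr0.
Qed.
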